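(* Let $(M,\omega)$ be a closed symplectic surface, let $\mathcal{U}=\{U_1,\dots,U_N\}$ be an open cover of $M$ by discs in general position, and let $\mathcal{F}=\{f_1,\dots,f_N\}\prec\mathcal{U}$ be a positive collection subordinate to $\mathcal{U}$. Let $\mu$ be a nonzero finite positive Borel measure on $M$ and set $\mu(\mathcal{U})=\max_{1\le i\le N}\mu(U_i)$. Then $$\int_M P_{\mathcal{F}}\,\omega\;\ge\;\frac{\mu(C_{\mathcal{F}})}{\mu(\mathcal{U})},$$ where $\mu(C_{\mathcal{F}})=\int_M C_{\mathcal{F}}\,d\mu$.
   Context: A symplectic surface $(M,\omega)$ is a smooth 2-manifold $M$ with an area form $\omega$. The symplectic gradient $X_H$ of $H\in C^\infty(M)$ is defined by $-\mathrm{d}H=\omega(X_H,\cdot)$, and the Poisson bracket is $\{G,H\}:=-\omega(X_G,X_H)$. A positive collection on $M$ is a locally finite collection $\mathcal{F}=\{f_i\}_{i\in I}$ of smooth functions $f_i:M\to[0,\infty)$ with $\sum_{i\in I}f_i(x)\ge 1$ for all $x\in M$. It is subordinate to a locally finite open cover $\mathcal{U}=\{U_i\}_{i\in I}$, written $\mathcal{F}\prec\mathcal{U}$, if $\mathrm{supp}(f_i)=\overline{\{f_i\ne0\}}\subseteq U_i$ for each $i\in I$. The Poisson bracket function of $\mathcal{F}$ is $P_{\mathcal{F}}(x):=\sum_{i,j\in I}|\{f_i,f_j\}(x)|$. A locally finite open cover $\mathcal{U}=\{U_i\}_{i\in I}$ of $M$ is in general position if the sets $U_i$ have smooth boundaries,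 the boundaries $\partial U_i$ and $\partial U_j$ intersect transversally for all $i\neq j$, and $\partial U_i\cap\partial U_j\cap\partial U_k=\varnothing$ for all triples of distinct indices. For $x\in M$ put $\mathcal{U}_x:=\{U_i\in\mathcal{U}: x\in U_i\}$ and $St(x):=\bigcup_{U_i\in\mathcal{U}_x}U_i$. The star function of $\mathcal{F}\prec\mathcal{U}$ is the measurable function $$C_{\mathcal{F}}:M\to[0,\infty),\qquad C_{\mathcal{F}}(x):=\int_{St(x)}\sum_{i\in I}\ \sum_{j:\,U_j\in\mathcal{U}_x}|\{f_i,f_j\}|\,\omega .$$ *)

(* Defs.v *)
From HB Require Import structures.
From mathcomp Require Import all_boot all_order all_algebra.
From mathcomp Require Import all_classical all_reals all_analysis.
From mathcomp Require Import measurable_realfun.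
From mathcomp Require Import ring lra.

Set Implicit Arguments.
Unset Strict Implicit.
Unset Printing Implicit Defensive.
Import Order.TTheory GRing.Theory Num.Theory.
Import numFieldNormedType.Exports.
Local Open Scope classical_set_scope.
Local Open Scope ring_scope.

(* The plane is [R * R], which carries both the normed space and the
   measurable structures used below. *)
Notation plane R := (R * R)%type (only parsing).

(* [A] is meant to be open: [f] is C^0 on [A] if it is continuous at the points
   of [A], and C^(k+1) if it is differentiable on [A] with all its directional
   derivatives C^k. *)
Fixpoint Ck_on (R : realType) (V W : normedModType R) (k : nat) (A : set V)
    (f : V -> W) : Prop :=
  if k is k'.+1 then
    (forall x, A x -> differentiable f x) /\
    (forall v : V, Ck_on k' A ('D_v f))
  else forall x, A x -> {for x, continuous f}.

Definition smooth_on (R : realType) (V W : normedModType R) (A : set V)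
  (f : V -> W) : Prop := forall k, Ck_on k A f.

(* A chart is a homeomorphism from the open set [cdom] of [M] onto an open set
   of the plane; [cmap] and [cinv] are total, with arbitrary values outside
   these sets. *)
Record chart (R : realType) (M : topologicalType) := Chart {
  cdom : set M ;
  cmap : M -> plane R ;
  cinv : plane R -> M ;
  cdom_open : open cdom ;
  crng_open : open (cmap @` cdom) ;
  cmapK : forall x, cdom x -> cinv (cmap x) = x ;
  cmap_cont : forall x, cdom x -> {for x, continuous cmap} ;
  cinv_cont : forall y, (cmap @` cdom) y -> {for y, continuous cinv} }.

Definition crng (R : realType) (M : topologicalType) (c : chart R M) :
  set (plane R) := cmap c @` cdom c.

Definition transition (R : realType) (M : topologicalType) (c d : chart R M) :
  plane R -> plane R := cmap d \o cinv c.

Definition smooth_compat (R : realType) (M : topologicalType)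
    (c d : chart R M) : Prop :=
  smooth_on (cmap c @` (cdom c `&` cdom d)) (transition c d) /\
  smooth_on (cmap d @` (cdom c `&` cdom d)) (transition d c).

(* A smooth structure is given by a countable atlas: every second countable
   manifold has one, and conversely a countable atlas entails second
   countability. *)
Record smooth_surface (R : realType) (M : topologicalType) := SmoothSurface {
  surf_hausdorff : hausdorff_space M ;
  atlas : nat -> chart R M ;
  atlas_cover : forall x, exists k, cdom (atlas k) x ;
  atlas_compat : forall k l, smooth_compat (atlas k) (atlas l) }.

(* The charts of the maximal smooth atlas. *)
Definition admissible (R : realType) (M : topologicalType)
    (S : smooth_surface R M) (c : chart R M) : Prop :=
  forall k, smooth_compat c (atlas S k).

Definition smooth_fun (R : realType) (M : topologicalType)
    (S : smooth_surface R M) (f : M -> R) : Prop :=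
  forall k, smooth_on (crng (atlas S k)) (f \o cinv (atlas S k)).

(* A tangent vector at [x] is represented by its components in a chart around
   [x], which change by the differential of the transition map. *)
Definition tangent_map (R : realType) (M : topologicalType)
    (S : smooth_surface R M) (k l : nat) (x : M) : plane R -> plane R :=
  'd (transition (atlas S k) (atlas S l)) (cmap (atlas S k) x).

Definition area2 (R : realType) (u v : plane R) : R := u.1 * v.2 - u.2 * v.1.

(* In the chart [k] the form at [x] is [dens k x] times [dx /\ dy]; [dens_compat]
   says that these local expressions define one and the same 2-form. *)
Record area_form (R : realType) (M : topologicalType)
    (S : smooth_surface R M) := AreaForm {
  dens : nat -> M -> R ;
  dens_smooth : forall k,
    smooth_on (crng (atlas S k)) (dens k \o cinv (atlas S k)) ;
  dens_neq0 : forall k x, cdom (atlas S k) x -> dens k x != 0 ;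
  dens_compat : forall k l x, cdom (atlas S k) x -> cdom (atlas S l) x ->
    forall u v : plane R,
    dens l x * area2 (tangent_map S k l x u) (tangent_map S k l x v) =
    dens k x * area2 u v }.

Section hamiltonian.
Variables (R : realType) (M : topologicalType) (S : smooth_surface R M).
Variable w : area_form S.

Definition omega (k : nat) (x : M) (u v : plane R) : R :=
  dens w k x * area2 u v.

Definition differential (k : nat) (H : M -> R) (x : M) : plane R -> R :=
  'd (H \o cinv (atlas S k)) (cmap (atlas S k) x).

(* The components in the chart [k] of the symplectic gradient of [H] at [x]. *)
Definition sgrad (k : nat) (H : M -> R) (x : M) : plane R :=
  xget 0 [set X | forall v, omega k x X v = - differential k H x v].

Definition chart_at (x : M) : nat := xget 0%N [set k | cdom (atlas S k) x].

(* By [pbracketE] below, any chart around [x] gives the same value. *)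
Definition pbracket (G H : M -> R) (x : M) : R :=
  - omega (chart_at x) x (sgrad (chart_at x) G x) (sgrad (chart_at x) H x).

End hamiltonian.


Section hamiltonian_theory.
Variables (R : realType) (M : topologicalType) (S : smooth_surface R M).
Variable w : area_form S.
Implicit Types (x : M) (f G H : M -> R).

Lemma sgradP k H x : cdom (atlas S k) x ->
  forall v, omega w k x (sgrad w k H x) v = - differential S k H x v.
Proof.
move=> kx; rewrite /sgrad.
case: xgetP => [y _ //|/(_ ((- differential S k H x (0, 1)) / dens w k x,
  differential S k H x (1, 0) / dens w k x)) []] v.
have -> : v = v.1 *: (1, 0) + v.2 *: (0, 1) :> plane R.
  by case: v => a b; rewrite /GRing.scale/= /GRing.add/= /add_pair/=;
     congr pair; rewrite /GRing.scale/=; ring.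
have d0 := dens_neq0 w kx.
rewrite /differential linearD !linearZ/= /omega /area2/=.
by rewrite /GRing.scale/=; field.
Qed.

Lemma sgrad_unique k H x (X : plane R) : cdom (atlas S k) x ->
  (forall v, omega w k x X v = - differential S k H x v) ->
  X = sgrad w k H x.
Proof.
move=> kx XP; have XQ := sgradP H kx; have d0 := dens_neq0 w kx.
have e v : area2 X v = area2 (sgrad w k H x) v.
  by apply: (mulfI d0); rewrite -/(omega w k x X v) XP -XQ.
move: (e (0, 1)) (e (1, 0)); rewrite /area2/= !mulr0 !mulr1 !subr0 !sub0r.
move=> e1 /oppr_inj e2.
by move: e1 e2; case: (X) (sgrad _ _ _ _) => [a b] [c d]/= -> ->.
Qed.

Lemma crng_cmap (c : chart R M) x : cdom c x -> crng c (cmap c x).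
Proof. by move=> cx; exists x. Qed.

Lemma smooth_differentiable (V W : normedModType R) (A : set V) (f : V -> W) :
  smooth_on A f -> forall y, A y -> differentiable f y.
Proof. by move=> /(_ 1%N)[]. Qed.

Lemma near_cinv (c : chart R M) x (A : set M) : cdom c x -> open A -> A x ->
  \forall y \near cmap c x, A (cinv c y).
Proof.
move=> cx oA Ax; apply: (cinv_cont (crng_cmap cx)); apply: open_nbhs_nbhs.
by split=> //; rewrite cmapK.
Qed.

Lemma differentiable_transition k l x :
  cdom (atlas S k) x -> cdom (atlas S l) x ->
  differentiable (transition (atlas S k) (atlas S l)) (cmap (atlas S k) x).
Proof.
move=> kx lx; have [+ _] := atlas_compat S k l.
by move/smooth_differentiable; apply; exists x.
Qed.

Lemma transition_cmap (c d : chart R M) x : cdom c x ->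
  transition c d (cmap c x) = cmap d x.
Proof. by move=> cx; rewrite /transition/= cmapK. Qed.

Lemma near_eq_diff (V W : normedModType R) (f g : V -> W) a :
  differentiable f a -> differentiable g a ->
  (\forall y \near a, f y = g y) -> forall v, 'd f a v = 'd g a v.
Proof.
move=> df dg fg v; rewrite -!deriveE//.
have [->|v0] := eqVneq v 0; first by rewrite !derive0.
exact: near_eq_derive.
Qed.

Lemma diff_comp_at (U V W : normedModType R) (t : U -> V) (h : V -> W) y z :
  t y = z -> differentiable t y -> differentiable h z ->
  differentiable (h \o t) y /\
  forall v, 'd (h \o t) y v = 'd h z ('d t y v).
Proof.
move=> <- dt dh; split=> [|v]; first exact: differentiable_comp.
exact: (congr1 (fun f : U -> W => f v) (diff_comp dt dh)).
Qed.

Lemma differential_tangent_map k l H x : smooth_fun S H ->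
  cdom (atlas S k) x -> cdom (atlas S l) x -> forall v,
  differential S k H x v = differential S l H x (tangent_map S k l x v).
Proof.
move=> sH kx lx v; rewrite /differential /tangent_map.
have dH m : cdom (atlas S m) x ->
    differentiable (H \o cinv (atlas S m)) (cmap (atlas S m) x).
  by move=> mx; apply: smooth_differentiable (sH m) _ (crng_cmap mx).
have [d dE] := @diff_comp_at _ _ _ _ (H \o cinv (atlas S l)) _ _
  (transition_cmap (atlas S l) kx) (differentiable_transition kx lx) (dH _ lx).
apply: etrans (dE v).
apply: (near_eq_diff (dH _ kx) d); near=> y.
rewrite /= /transition/= cmapK//.
by near: y; apply: near_cinv => //; exact: cdom_open.
Unshelve. all: by end_near. Qed.

Lemma tangent_mapK k l x : cdom (atlas S k) x -> cdom (atlas S l) x ->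
  cancel (tangent_map S k l x) (tangent_map S l k x).
Proof.
move=> kx lx v; rewrite /tangent_map.
have [d dE] := @diff_comp_at _ _ _ _ (transition (atlas S l) (atlas S k)) _ _
  (transition_cmap (atlas S l) kx) (differentiable_transition kx lx)
  (differentiable_transition lx kx).
have did := @ex_diff _ _ _ _ _ _ _ (is_diff_id (cmap (atlas S k) x)).
apply: etrans (esym (dE v)) _.
have idE : 'd id (cmap (atlas S k) x) v = v.
  by rewrite (@diff_val _ _ _ _ _ _ _ (is_diff_id (cmap (atlas S k) x))).
apply: etrans idE.
apply: (near_eq_diff d did); near=> y.
have yl : cdom (atlas S l) (cinv (atlas S k) y).
  by near: y; apply: near_cinv => //; exact: cdom_open.
have : crng (atlas S k) y.
  by near: y; apply: open_nbhs_nbhs; split;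
    [exact: crng_open|exact: crng_cmap].
by rewrite /= /transition/= cmapK// => -[z kz <-]; rewrite cmapK.
Unshelve. all: by end_near. Qed.

Lemma sgrad_tangent_map k l H x : smooth_fun S H ->
  cdom (atlas S k) x -> cdom (atlas S l) x ->
  sgrad w l H x = tangent_map S k l x (sgrad w k H x).
Proof.
move=> sH kx lx; apply/esym/sgrad_unique => // v.
rewrite -(tangent_mapK lx kx v) /omega dens_compat// -/(omega w k x _ _).
by rewrite sgradP// (differential_tangent_map sH kx lx).
Qed.

Lemma chart_atP x : cdom (atlas S (chart_at S x)) x.
Proof.
by rewrite /chart_at; case: xgetP => // n0; have [k] := atlas_cover S x => /n0.
Qed.

Lemma pbracketE k G H x : smooth_fun S G -> smooth_fun S H ->
  cdom (atlas S k) x ->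
  pbracket w G H x = - omega w k x (sgrad w k G x) (sgrad w k H x).
Proof.
move=> sG sH kx; have lx := chart_atP x; set l := chart_at S x in lx.
have -> : pbracket w G H x =
  - omega w l x (sgrad w l G x) (sgrad w l H x) by [].
have -> := sgrad_tangent_map sG kx lx; have -> := sgrad_tangent_map sH kx lx.
by congr (- _); exact: dens_compat.
Qed.

End hamiltonian_theory.

Notation borel M := (g_sigma_algebraType (@open M)).

Lemma open_plane_measurable (R : realType) (A : set (plane R)) :
  open A -> measurable A.
Proof.
move=> oA.
pose B (q : rat * rat * rat) : set (plane R) :=
  ball (ratr q.1.1 : R) (ratr q.2 : R) `*` ball (ratr q.1.2 : R) (ratr q.2 : R).
pose D := [set q | B q `<=` A].
have -> : A = \bigcup_(q in D) B q.
  rewrite eqEsubset; split=> [[x1 x2] Ax|x [q Dq Bqx]]; last exact: Dq.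
  have [e /= e0 eA] : nbhs_ball (x1, x2) A by apply/nbhs_ballP; exact: oA.
  have e2 : 0 < e / 2 by rewrite divr_gt0.
  have [r] := rat_in_itvoo e2; rewrite in_itv/= => /andP[r0 re].
  have rr0 : 0 < (ratr r : R) by [].
  have xr (z : R) : z < z + ratr r by rewrite ltrDl.
  have [q1] := rat_in_itvoo (xr x1); rewrite in_itv/= => /andP[q1l q1r].
  have [q2] := rat_in_itvoo (xr x2); rewrite in_itv/= => /andP[q2l q2r].
  exists ((q1, q2), r).
    move=> [y1 y2] [/= b1 b2]; apply: eA; split=> /=.
      move: b1; rewrite /ball/= => b1.
      rewrite (_ : x1 - y1 = (x1 - ratr q1) + (ratr q1 - y1)); last by ring.
      rewrite (le_lt_trans (ler_normD _ _))// (splitr e) ltrD//; last exact: lt_trans re.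
      rewrite (lt_trans _ re)// distrC ger0_norm ?subr_ge0 ?ltW//; lra.
    move: b2; rewrite /ball/= => b2.
    rewrite (_ : x2 - y2 = (x2 - ratr q2) + (ratr q2 - y2)); last by ring.
    rewrite (le_lt_trans (ler_normD _ _))// (splitr e) ltrD//; last exact: lt_trans re.
    rewrite (lt_trans _ re)// distrC ger0_norm ?subr_ge0 ?ltW//; lra.
  split=> /=; rewrite /ball/= ger0_norm ?subr_ge0 ?ltW//; lra.
rewrite bigcup_mkcond; apply: countable_bigcupT_measurable => // q.
by case: ifPn => // _; apply: measurableX; exact: open_measurable (ball_open _ _).
Qed.

Section area_measure.
Variables (R : realType) (M : ptopologicalType) (S : smooth_surface R M).
Variable w : area_form S.

Lemma open_preimage_chart (T : topologicalType) (A : set (plane R))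
    (g : plane R -> T) (O : set T) :
  open A -> (forall y, A y -> {for y, continuous g}) -> open O ->
  open (A `&` g @^-1` O).
Proof.
move=> oA cg oO; rewrite openE => y [Ay Ogy].
rewrite /interior; apply: filterI; first exact: open_nbhs_nbhs.
by apply: (cg _ Ay); exact: open_nbhs_nbhs.
Qed.

Lemma measurable_cinv (c : chart R M) :
  measurable_fun (crng c) (cinv c : plane R -> borel M).
Proof.
apply: (@measurability _ _ (plane R) (borel M) _ _ (@open M)) => // _ [B oB <-].
apply: open_plane_measurable; apply: open_preimage_chart => //.
- exact: crng_open.
- exact: cinv_cont.
Qed.

Lemma measurable_dens (c : chart R M) (f : M -> R) :
  smooth_on (crng c) (f \o cinv c) -> measurable_fun (crng c) (f \o cinv c).
Proof.
move=> /(_ 0%N) /= sf.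
apply: (@measurability _ _ (plane R) R _ _ _ (RGenOpens.measurableE R)) => // _ [B [a [b ->]] <-].
apply: open_plane_measurable; apply: open_preimage_chart => //.
exact: crng_open.
Qed.

Lemma image_chart (c : chart R M) (A : set M) : A `<=` cdom c ->
  cmap c @` A = crng c `&` cinv c @^-1` A.
Proof.
move=> Ac; rewrite eqEsubset; split=> [_ [x Ax <-]|_ [[x cx <-]]]/=.
  by split; [exists x => //; exact: Ac|rewrite /= cmapK//; exact: Ac].
by rewrite cmapK// => Ax; exists x.
Qed.

Lemma measurable_crng (c : chart R M) : measurable (crng c).
Proof. by apply: open_plane_measurable; exact: crng_open. Qed.

Lemma measurable_image_chart (c : chart R M) (A : set (borel M)) :
  A `<=` cdom c -> measurable A -> measurable (cmap c @` A).
Proof.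
by move=> Ac mA; rewrite image_chart//; apply: measurable_cinv => //;
  exact: measurable_crng.
Qed.

(* The part of the [k]-th chart domain outside the previous ones; these pieces
   partition [M]. *)
Definition piece (k : nat) : set M := seqDU (fun i => cdom (atlas S i)) k.

Lemma piece_sub k : piece k `<=` cdom (atlas S k).
Proof. exact: subset_seqDU. Qed.

Lemma measurable_piece k : measurable (piece k : set (borel M)).
Proof.
apply: seqDU_measurable => i; apply: sub_sigma_algebra; exact: cdom_open.
Qed.

Definition area_piece (k : nat) (A : set (borel M)) : \bar R :=
  (\int[(@lebesgue_measure R \x @lebesgue_measure R)]_(y in
      cmap (atlas S k) @` (A `&` piece k))
    (`|dens w k (cinv (atlas S k) y)|)%:E)%E.

Lemma area_piece0 k : area_piece k set0 = 0%E.
Proof. by rewrite /area_piece set0I image_set0 integral_set0. Qed.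

Lemma area_piece_ge0 k A : (0 <= area_piece k A)%E.
Proof. by apply: integral_ge0 => y _; rewrite lee_fin. Qed.

Lemma area_piece_sigma_additive k : semi_sigma_additive (area_piece k).
Proof.
move=> F mF tF _; rewrite /area_piece setI_bigcupl image_bigcup.
pose G i := cmap (atlas S k) @` (F i `&` piece k).
have Gk i : F i `&` piece k `<=` cdom (atlas S k).
  by move=> x [_ /piece_sub].
have mG i : measurable (G i).
  apply: measurable_image_chart => //.
  by apply: measurableI => //; exact: measurable_piece.
have tG : trivIset setT G.
  apply/trivIsetP => i j _ _ ij; move/trivIsetP : tF => /(_ i j I I ij) Fij.
  rewrite -subset0 => y [[x [Fix px] <-] [z [Fjz pz]] exz].
  have zx : z = x.
    rewrite -(cmapK (piece_sub px)) -(cmapK (piece_sub pz)).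
    by congr (cinv _ _).
  suff : (F i `&` F j) x by rewrite Fij.
  by split=> //; rewrite -zx.
have mf : measurable_fun (\bigcup_i G i)
    (fun y => (`|dens w k (cinv (atlas S k) y)|)%:E).
  apply/measurable_EFinP; apply: (measurable_funS (measurable_crng (atlas S k))).
    by move=> y [i _ [x /Gk kx <-]]; exact: crng_cmap.
  by apply: measurableT_comp => //; apply: measurable_dens; exact: dens_smooth.
have := @ge0_integral_bigcup _ _ R
  (@lebesgue_measure R \x @lebesgue_measure R)%E G _ mG mf _ tG.
rewrite /G => ->; last by move=> *; rewrite lee_fin.
apply: is_cvg_nneseries => i _ _.
by apply: integral_ge0 => y _; rewrite lee_fin.
Qed.

HB.instance Definition _ k := isMeasure.Build _ _ _ (area_piece k)
  (area_piece0 k) (@area_piece_ge0 k) (@area_piece_sigma_additive k).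

(* The measure [A |-> \int_A w] for the orientation defined by [w]; by the
   change of variables formula it does not depend on how [M] is cut into pieces
   contained in chart domains. *)
Definition area : {measure set (borel M) -> \bar R} :=
  mseries (fun k => area_piece k : {measure set (borel M) -> \bar R}) 0.

End area_measure.

Section covers.
Variables (R : realType) (M : topologicalType) (S : smooth_surface R M).

Definition unit_disc : set (plane R) := [set y | y.1 ^+ 2 + y.2 ^+ 2 < 1].

(* [U] is diffeomorphic to the open unit disc of the plane. *)
Definition is_disc (U : set M) : Prop :=
  exists c, [/\ admissible S c, cdom c = U & crng c = unit_disc].

Definition boundary (A : set M) : set M := closure A `\` A°.

(* Around each boundary point, [U] is a half-plane in suitable coordinates. *)
Definition smooth_boundary (U : set M) : Prop :=
  forall x, boundary U x -> exists c, [/\ admissible S c, cdom c x &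
    cdom c `&` U = cdom c `&` [set z | (cmap c z).1 < 0]].

(* The tangent space at [x] of the submanifold [A], in the chart [k]: the
   velocities at [x] of the smooth curves drawn on [A]. *)
Definition tangent_space (A : set M) (k : nat) (x : M) : set (plane R) :=
  [set v | exists g : R -> plane R,
    [/\ smooth_on setT g, g 0 = cmap (atlas S k) x,
        (\forall t \near 0,
           (cmap (atlas S k) @` (A `&` cdom (atlas S k))) (g t)) &
        derive1 g 0 = v]].

Definition transverse (A B : set M) : Prop :=
  forall k x, A x -> B x -> cdom (atlas S k) x ->
  forall v, exists a b, [/\ tangent_space A k x a, tangent_space B k x b &
    v = a + b].

Definition open_cover_of (I : Type) (U : I -> set M) : Prop :=
  (forall i, open (U i)) /\ \bigcup_i U i = setT.

Definition general_position (I : Type) (U : I -> set M) : Prop :=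
  [/\ forall i, smooth_boundary (U i),
      forall i j, i <> j -> transverse (boundary (U i)) (boundary (U j)) &
      forall i j l, i <> j -> j <> l -> i <> l ->
        boundary (U i) `&` boundary (U j) `&` boundary (U l) = set0].

Definition positive_collection (I : finType) (f : I -> M -> R) : Prop :=
  [/\ forall i, smooth_fun S (f i), forall i x, 0 <= f i x &
      forall x, 1 <= \sum_i f i x].

Definition supp (f : M -> R) : set M := closure [set x | f x != 0].

Definition subordinate (I : Type) (f : I -> M -> R) (U : I -> set M) : Prop :=
  forall i, supp (f i) `<=` U i.

Definition star (I : Type) (U : I -> set M) (x : M) : set M :=
  \bigcup_(i in [set i | U i x]) U i.

End covers.

Definition pbfun (R : realType) (M : topologicalType) (S : smooth_surface R M)
    (w : area_form S) (I : finType) (f : I -> M -> R) (x : M) : R :=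
  \sum_i \sum_j `|pbracket w (f i) (f j) x|.

Definition starfun (R : realType) (M : ptopologicalType)
    (S : smooth_surface R M) (w : area_form S) (I : finType)
    (U : I -> set M) (f : I -> M -> R) (x : M) : \bar R :=
  (\int[area w]_(y in star U x)
    (\sum_i \sum_(j | x \in U j) `|pbracket w (f i) (f j) y|)%:E)%E.

(* Main.v *)
Require Import Defs.
From mathcomp Require Import all_boot all_order all_algebra.
From mathcomp Require Import all_classical all_reals all_analysis.
From mathcomp Require Import measurable_realfun.
From mathcomp Require Import ring.

Set Implicit Arguments.
Unset Strict Implicit.
Unset Printing Implicit Defensive.
Import Order.TTheory GRing.Theory Num.Theory.
Import numFieldNormedType.Exports.

Local Open Scope classical_set_scope.
Local Open Scope ring_scope.

(** Each star integral splits into masses that do not depend on the point.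
    For an index j put m_j = \int_M \sum_i |{f_i, f_j}| w. The bracket
    {f_i, f_j} vanishes off the support of f_j, hence off U_j; and for x in U_j
    the whole of U_j lies in the star of x. So in C_F(x) the integral over the
    star may be taken over M, and C_F(x) is the sum of the m_j with x in U_j
    ([starfunE]). Thus C_F is a step function, and integrating it against mu
    gives \sum_j mu(U_j) m_j ([integral_sum_indic]). Replacing each mu(U_j) by
    the maximum mu(U) bounds this by mu(U) \sum_j m_j, and \sum_j m_j is the
    integral of P_F. It remains to divide by mu(U), which is finite because mu
    is, and positive because the U_j cover M and mu is nonzero
    ([bigmax_measure_gt0]).

    Exchanging the finite sums with the integral against w needs the brackets
    to be Borel functions. They are even continuous: in a chart a bracket is
    the Jacobian determinant of two smooth functions divided by the
    nonvanishing density of w ([pbracket_chart]). *)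

(** * The Poisson bracket of smooth functions *)

Section poisson_bracket.
Variables (R : realType) (M : topologicalType) (S : smooth_surface R M).
Variable w : area_form S.
Implicit Types (G H : M -> R) (x : M).

Lemma smooth_fun_differentiable G k x : smooth_fun S G -> cdom (atlas S k) x ->
  differentiable (G \o cinv (atlas S k)) (cmap (atlas S k) x).
Proof.
by move=> sG kx; apply: smooth_differentiable (sG k) _ (crng_cmap kx).
Qed.

Definition chart_deriv k (v : plane R) H x : R :=
  'D_v (H \o cinv (atlas S k)) (cmap (atlas S k) x).

(** Evaluating the equation that defines the symplectic gradient on the two
    coordinate vectors gives its components, from which the bracket is read
    off. This formula yields both the continuity and the support of the
    bracket. *)
Lemma pbracket_chart k G H x : smooth_fun S G -> smooth_fun S H ->
  cdom (atlas S k) x ->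
  pbracket w G H x =
  (chart_deriv k (0, 1) G x * chart_deriv k (1, 0) H x -
   chart_deriv k (1, 0) G x * chart_deriv k (0, 1) H x) / dens w k x.
Proof.
move=> sG sH kx; rewrite (pbracketE w sG sH kx).
have d0 := dens_neq0 w kx.
rewrite /chart_deriv !deriveE; try exact: smooth_fun_differentiable.
rewrite -!/(differential S k _ x _).
have sgradE K : sgrad w k K x =
    (- differential S k K x (0, 1) / dens w k x,
     differential S k K x (1, 0) / dens w k x).
  have := sgradP w K kx (1, 0); have := sgradP w K kx (0, 1).
  case: (sgrad _ _ _ _) => a b; rewrite /omega /area2/=.
  rewrite !mulr0 !mulr1 subr0 sub0r => ea /eqP.
  rewrite mulrN eqr_opp => /eqP eb.
  by rewrite -ea -eb; congr pair; field.
by rewrite !sgradE /omega /area2/=; field.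
Qed.

(** The derivative is continuous because the function is C^1 in the chart. *)
Lemma continuous_chart_deriv k v H x : smooth_fun S H ->
  cdom (atlas S k) x -> {for x, continuous (chart_deriv k v H)}.
Proof.
move=> sH kx; apply: (@continuous_comp _ _ _ (cmap (atlas S k))
  ('D_v (H \o cinv (atlas S k)))); first exact: cmap_cont.
have [_ /(_ v) cD] := sH k 1%N.
exact: cD (crng_cmap kx).
Qed.

Lemma near_cdom k x : cdom (atlas S k) x ->
  \forall y \near x, cdom (atlas S k) y.
Proof. by move=> kx; apply: open_nbhs_nbhs; split=> //; exact: cdom_open. Qed.

Lemma continuous_dens k x : cdom (atlas S k) x ->
  {for x, continuous (dens w k)}.
Proof.
move=> kx.
have c : {for x, continuous
    ((dens w k \o cinv (atlas S k)) \o cmap (atlas S k))}.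
  apply: continuous_comp; first exact: cmap_cont.
  by have := dens_smooth w k 0%N; apply; exact: crng_cmap.
move: c; rewrite /prop_for /continuous_at /= cmapK//; apply: cvg_trans.
apply: near_eq_cvg; near=> y; rewrite /= cmapK//.
by near: y; exact: near_cdom.
Unshelve. all: by end_near. Qed.

Lemma continuous_pbracket G H : smooth_fun S G -> smooth_fun S H ->
  continuous (pbracket w G H).
Proof.
move=> sG sH x; have [k kx] := atlas_cover S x.
rewrite /continuous_at (pbracket_chart sG sH kx).
have cG v := continuous_chart_deriv (v := v) sG kx.
have cH v := continuous_chart_deriv (v := v) sH kx.
have : (chart_deriv k (0, 1) G \* chart_deriv k (1, 0) H \-
         chart_deriv k (1, 0) G \* chart_deriv k (0, 1) H) \*
        (fun y => (dens w k y)^-1) @ x -->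
    (chart_deriv k (0, 1) G x * chart_deriv k (1, 0) H x -
     chart_deriv k (1, 0) G x * chart_deriv k (0, 1) H x) / dens w k x.
  apply: cvgM; last exact: cvgV (dens_neq0 w kx) (continuous_dens kx).
  by apply: cvgB; apply: cvgM; [exact: cG|exact: cH|exact: cG|exact: cH].
apply: cvg_trans.
apply: near_eq_cvg; near=> y; rewrite (@pbracket_chart k)//.
by near: y; exact: near_cdom.
Unshelve. all: by end_near. Qed.

(** Off its support, H vanishes on a neighbourhood, so that both of its
    derivatives in [pbracket_chart] vanish. *)
Lemma pbracket_supp0 G H x : smooth_fun S G -> smooth_fun S H ->
  ~ supp H x -> pbracket w G H x = 0.
Proof.
move=> sG sH Hx; have [k kx] := atlas_cover S x.
have dH0 v : chart_deriv k v H x = 0.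
  rewrite /chart_deriv deriveE; last exact: smooth_fun_differentiable.
  rewrite (@near_eq_diff _ _ _ _ (cst 0)) ?diff_cst//.
    exact: smooth_fun_differentiable.
  near=> y; apply/eqP; apply: contrapT => /negP Hy.
  have : (~` supp H) (cinv (atlas S k) y).
    near: y; apply: near_cinv => //; rewrite openC; exact: closed_closure.
  by apply; apply: subset_closure.
by rewrite (pbracket_chart sG sH kx) !dH0 !mulr0 subrr mul0r.
Unshelve. all: by end_near. Qed.

End poisson_bracket.

Lemma continuous_borel_measurable (R : realType) (M : ptopologicalType)
  (g : M -> R) : continuous g -> measurable_fun setT (g : borel M -> R).
Proof.
move=> /continuousP cg.
apply: (@measurability _ _ (borel M) R _ _ _ (RGenOpens.measurableE R)) => //.
move=> _ [B [a [b ->]] <-]; rewrite setTI.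
by apply: sub_sigma_algebra; apply: cg.
Qed.

(** * Weighted sums over a finite family of measurable sets *)

Section double_counting.
Local Open Scope ereal_scope.
Variables (R : realType) (d : measure_display) (T : measurableType d).
Variables (I : finType) (U : I -> set T) (c : I -> \bar R).
Variable mu : {measure set T -> \bar R}.
Hypothesis c0 : forall i, 0 <= c i.

(** Double counting: the weight c_i is collected exactly at the points of
    U_i. *)
Lemma integral_sum_indic : (forall i, measurable (U i)) ->
  \int[mu]_x (\sum_(i | x \in U i) c i) = \sum_i mu (U i) * c i.
Proof.
move=> mU; transitivity (\int[mu]_x (\sum_i (\1_(U i) x)%:E * c i)).
  apply: eq_integral => x _; rewrite big_mkcond/=; apply: eq_bigr => i _.
  by rewrite indicE; case: (x \in U i); rewrite ?mul1e ?mul0e.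
have m1 i : measurable_fun [set: T] (fun x => (\1_(U i) x)%:E : \bar R).
  by apply/measurable_EFinP; exact: measurable_indic.
rewrite ge0_integral_sum//=; last 2 first.
- by move=> i; apply: emeasurable_funM => //; exact: measurable_cst.
- by move=> i x _; rewrite mule_ge0// lee_fin.
apply: eq_bigr => i _; rewrite ge0_integralZr// ?integral_indic ?setIT//.
Qed.

Lemma sum_measure_le_bigmax :
  \sum_i mu (U i) * c i <= \big[maxe/0]_i mu (U i) * \sum_i c i.
Proof.
rewrite ge0_sume_distrr//; apply: lee_sum => i _.
by rewrite lee_wpmul2r//; exact: le_bigmax.
Qed.

End double_counting.

(** If the maximum were zero, the whole space would be a finite union of null
    sets. *)
Lemma bigmax_measure_gt0 (R : realType) (d : measure_display)
    (T : measurableType d) (I : finType) (U : I -> set T)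
    (mu : {measure set T -> \bar R}) :
  (forall i, measurable (U i)) -> \bigcup_i U i = setT -> mu setT <> 0%E ->
  (0 < \big[maxe/0]_i mu (U i))%E.
Proof.
move=> mU covU mu0; rewrite lt0e bigmax_ge_id andbT.
apply/negP => /eqP m0; apply: mu0.
have : (measurable `&` [set A | mu A = 0%E]) (\big[setU/set0]_i U i).
  apply: (big_ind (measurable `&` [set A | mu A = 0%E])).
  - by split=> //=; rewrite measure0.
  - move=> A B [mA A0] [mB B0]; split; first exact: measurableU.
    exact: null_set_setU.
  - move=> i _; split=> //=; apply/eqP.
    by rewrite eq_le measure_ge0 andbT -m0 le_bigmax.
have -> : \big[setU/set0]_i U i = setT.
  rewrite -subTset -covU => x [i _ Uix].
  by rewrite (bigD1 i)//=; left.
by case.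
Qed.

(** * The star function *)

Section star_function.
Local Open Scope ereal_scope.
Variables (R : realType) (M : ptopologicalType) (S : smooth_surface R M).
Variables (w : area_form S) (I : finType) (U : I -> set M) (f : I -> M -> R).
Hypothesis sf : forall i, smooth_fun S (f i).

(** The share of the index j in the integral of the Poisson bracket function. *)
Definition pbmass (j : I) : \bar R :=
  \int[area w]_y (\sum_i `|pbracket w (f i) (f j) y|)%:E.

Lemma pbmass_ge0 j : 0 <= pbmass j.
Proof. by apply: integral_ge0 => y _; rewrite lee_fin sumr_ge0. Qed.

Lemma measurable_pbmass j : measurable_fun [set: borel M]
  (fun y => (\sum_i `|pbracket w (f i) (f j) y|)%:E).
Proof.
apply/measurable_EFinP; apply: measurable_sum => i.
apply: measurableT_comp => //; apply: continuous_borel_measurable.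
exact: continuous_pbracket.
Qed.

(** The sum over j is kept restricted to P: all indices give the integral of
    the Poisson bracket function, those with x in U_j give the star function
    at x. *)
Lemma integral_sum_pbracket (P : pred I) :
  \int[area w]_y (\sum_i \sum_(j | P j) `|pbracket w (f i) (f j) y|)%:E =
  \sum_(j | P j) pbmass j.
Proof.
rewrite -big_filter -ge0_integral_sum//; last 2 first.
- by move=> j; exact: measurable_pbmass.
- by move=> j y _; rewrite lee_fin sumr_ge0.
apply: eq_integral => y _; rewrite exchange_big/= -sumEFin.
by rewrite big_filter.
Qed.

(** For j with x in U_j, the brackets with f_j live on U_j, which is part of
    the star of x; integrating over the star is integrating over M. *)
Lemma starfunE x : subordinate f U ->
  starfun w U f x = \sum_(j | x \in U j) pbmass j.
Proof.
move=> fU; rewrite -integral_sum_pbracket /starfun integral_mkcond.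
apply: eq_integral => y _; rewrite patchE; case: ifPn => // /negP sy.
congr EFin; rewrite big1// => i _; rewrite big1// => j xj.
rewrite pbracket_supp0 ?normr0// => /fU Ujy; apply: sy.
by apply/mem_set; exists j => //=; exact/set_mem.
Qed.

End star_function.

Theorem theorem1p4p16 (R : realType) (M : ptopologicalType)
  (S : smooth_surface R M) (w : area_form S)
  (N : nat) (U : 'I_N -> set M) (f : 'I_N -> M -> R)
  (mu : {finite_measure set (borel M) -> \bar R}) :
  compact [set: M] ->
  open_cover_of U ->
  (forall i, is_disc S (U i)) ->
  general_position S U ->
  positive_collection S f ->
  subordinate f U ->
  mu [set: M] <> 0%E ->
  ((\int[mu]_x starfun w U f x) / \big[maxe/0]_(i < N) mu (U i)
     <= \int[area w]_x (pbfun w f x)%:E)%E.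
Proof.
move=> _ [oU covU] _ _ [sf _ _] fU mu0.
have mU i : measurable (U i : set (borel M)) by exact: sub_sigma_algebra.
have maxgt0 := bigmax_measure_gt0 mU covU mu0.
have maxfin : (\big[maxe/0]_(i < N) mu (U i) < +oo)%E.
  apply/bigmax_ltP; split=> // i _; rewrite ltey_eq.
  by rewrite fin_num_measure.
under eq_integral do rewrite (starfunE w sf _ fU).
rewrite /pbfun (integral_sum_pbracket w sf predT) integral_sum_indic//; last first.
  by move=> i; exact: pbmass_ge0.
have := @sum_measure_le_bigmax _ _ (borel M) _ U _ mu (pbmass_ge0 w f).
case: (\big[_/_]_i mu (U i))%E maxgt0 maxfin => // m; rewrite lte_fin => m0 _.
by rewrite inver (gt_eqF m0) lee_pdivrMr// muleC.
Qed.
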